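(* Let $A,B\in\mathbb{Q}$. If the polynomial $f(z)=z^3+Az+B$ is post-critically finite, then \[(A,B)\in\left\{(-3,0),\ \left(-\tfrac{3}{2},0\right),\ \left(-\tfrac{3}{4},\tfrac{3}{4}\right),\ \left(-\tfrac{3}{4},-\tfrac{3}{4}\right),\ (0,0),\ \left(\tfrac{3}{2},0\right),\ (3,0)\right\}.\]
   Context: A polynomial $f$ is post-critically finite if every critical point $c\in\mathbb{C}$ of $f$ has finite forward orbit $\{f^n(c):n\geq 0\}$, where $f^n$ is the $n$-th iterate. *)

(* Defs.v *)
From mathcomp Require Import all_boot all_order all_algebra.
From mathcomp Require Import classical_sets cardinality reals.
From mathcomp Require Import complex.
Set Implicit Arguments.
Unset Strict Implicit.
Unset Printing Implicit Defensive.
Import GRing.Theory.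
Local Open Scope classical_set_scope.
Local Open Scope ring_scope.
Local Open Scope complex_scope.

(* Here and below, R[i] for an arbitrary model R of the real numbers plays the
   role of the field of complex numbers. *)
Definition orbit (R : realType) (f : {poly R[i]}) (z : R[i]) : set R[i] :=
  [set iter n (horner f) z | n in [set: nat]].

Definition critical_point (R : realType) (f : {poly R[i]}) (c : R[i]) : Prop :=
  root f^`() c.

Definition post_critically_finite (R : realType) (f : {poly R[i]}) : Prop :=
  forall c : R[i], critical_point f c -> finite_set (orbit f c).

Definition cubic (R : realType) (A B : rat) : {poly R[i]} :=
  'X^3 + (ratr A)%:P * 'X + (ratr B)%:P.

(* Main.v *)
Require Import Defs.
From mathcomp Require Import all_boot all_order all_algebra.
From mathcomp Require Import algC algnum.
From mathcomp Require Import classical_sets cardinality reals.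
From mathcomp Require Import complex.
From mathcomp Require Import ring zify.
Set Implicit Arguments.
Unset Strict Implicit.
Unset Printing Implicit Defensive.
Import Order.TTheory GRing.Theory Num.Theory.
Local Open Scope ring_scope.

(** Write [A = - 3 k / 4] and [B = m / 4]; the critical points are [c] and [- c]
with [c ^+ 2 = k / 4], and post-critical finiteness makes both of them
preperiodic.  A preperiodic point is small at every place, and so are the
parameters: this leaves finitely many of them.

At infinity, a point with [`|z| >= `|B|] and [`|z| ^+ 2 > `|A| + 2] has a
strictly increasing orbit in norm ([cubic_map_escape]).  Applied to the critical
values, whose sum is [2 * B] and whose difference is [- k * c], this bounds
[m] and [k] ([parameters_bound]).

At the finite places, if [d], [d ^+ 2 * A] and [d ^+ 3 * B] are algebraic
integers, then so is [d * z] for every preperiodic [z], because the equation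
[f^i z = f^j z], rescaled by [d], is monic with integral coefficients
([integral_preperiodic]).  If [n] is a common denominator of [k] and [m], then
[d = 2 * sqrt n] qualifies, and the critical values show that
[n * k ^+ 3] and [n * m ^+ 2] are integers
([critical_value_integrality]).  By minimality of [n] this forces [n = 1]
([int_of_common_denominators]), so that [k] and [m] are integers.

There remain the 153 pairs with [`|k| <= 4] and [`|m| <= 8].  With [d = 2] the
pairs [(2 z, 2 w)], with [z] and [w] the i-th iterates of [c] and [- c], have
integral sum and product, both bounded, and both computable from the previous
ones by integer polynomials divided by 4 and 16.  Three steps of this
recurrence eliminate all pairs but the seven of the statement
([small_survivors]). *)

(** * Preperiodic points *)

Definition preperiodic (T : Type) (f : T -> T) (z : T) : Prop :=
  exists i j, (i < j)%N /\ iter i f z = iter j f z.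

Lemma preperiodic_iter (T : Type) (f : T -> T) (z : T) n :
  preperiodic f z -> preperiodic f (iter n f z).
Proof.
move=> [i [j [ltij eqij]]]; exists i, j; split=> //.
by rewrite -!iterD ![(_ + n)%N]addnC !iterD eqij.
Qed.

Lemma eq_preperiodic (T : Type) (f g : T -> T) (z : T) :
  f =1 g -> preperiodic f z -> preperiodic g z.
Proof.
by move=> eq_fg [i [j [ltij eqij]]]; exists i, j; rewrite -!(eq_iter eq_fg).
Qed.

Lemma finite_orbit_preperiodic (R : realType) (f : {poly complex R}) z :
  finite_set (Defs.orbit f z) -> preperiodic (horner f) z.
Proof.
case/finite_seqP=> s orb_s; pose u n := iter n (horner f) z.
have u_s n : u n \in s.
  suff : [set` s]%classic (u n) by [].
  by rewrite -orb_s; exists n.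
have /(uniqPn 0)[i [j [ltij]]] : ~~ uniq (map u (iota 0 (size s).+1)).
  apply/negP=> uniq_u; have sub_u : {subset map u (iota 0 (size s).+1) <= s}.
    by move=> x /mapP[n _ ->].
  by have := uniq_leq_size uniq_u sub_u; rewrite size_map size_iota ltnn.
rewrite size_map size_iota => ltj.
rewrite !(nth_map 0%N) ?size_iota ?(ltn_trans ltij) // !nth_iota ?(ltn_trans ltij) //.
by exists i, j.
Qed.

Definition cubic_map (K : pzRingType) (a b z : K) : K := z ^+ 3 + a * z + b.

(** * The bound at infinity *)

Section Escape.
Variables (K : numDomainType) (a b : K).
Implicit Types z w : K.

(** The cubic term wins: [`|z| ^+ 3] exceeds [(`|a| + 2) * `|z|], which already
contains [`|a * z|], [`|b|] and one more [`|z|]. *)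
Lemma cubic_map_escape z :
  `|b| <= `|z| -> `|a| + 2 < `|z| ^+ 2 -> `|z| < `|cubic_map a b z|.
Proof.
move=> leb lta.
have z_gt0 : 0 < `|z|.
  have z2_gt0 : 0 < `|z| ^+ 2 by apply: le_lt_trans lta; rewrite addr_ge0.
  by rewrite lt0r normr_ge0 andbT -sqrf_eq0 gt_eqF.
have lt3 : (`|a| + 2) * `|z| < `|z| ^+ 3 by rewrite exprSr ltr_pM2r.
have le3 : `|z| ^+ 3 <= `|cubic_map a b z| + `|a| * `|z| + `|b|.
  have -> : `|z| ^+ 3 = `|cubic_map a b z - a * z - b|.
    by rewrite -normrX /cubic_map; congr `|_|; ring.
  rewrite -normrM; apply: le_trans (ler_normB _ _) _.
  by rewrite lerD2r ler_normB.
have := lt_le_trans lt3 le3.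
have -> : (`|a| + 2) * `|z| = `|z| + `|a| * `|z| + `|z| by ring.
move=> lt4; have := lt_le_trans lt4 (lerD (lexx _) leb).
by rewrite !ltrD2r.
Qed.

(** The two hypotheses of [cubic_map_escape] are inherited by the image of [z], so
otherwise the norm would increase along the whole orbit. *)
Lemma preperiodic_bound z : preperiodic (cubic_map a b) z ->
  `|b| <= `|z| -> `|z| ^+ 2 <= `|a| + 2.
Proof.
move=> [i [j [ltij eqij]]] leb.
rewrite real_leNgt ?realD ?realX ?normr_real ?realn //; apply/negP => lta.
pose u n := `|iter n (cubic_map a b) z|.
have uP n : [/\ u n < u n.+1, `|b| <= u n & `|a| + 2 < u n ^+ 2].
  elim: n => [|n [lt1 leb1 lta1]]; first by split=> //; apply: cubic_map_escape.
  have leb2 : `|b| <= u n.+1 by exact: le_trans (ltW lt1).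
  have lta2 : `|a| + 2 < u n.+1 ^+ 2.
    by apply: lt_le_trans lta1 _; rewrite lerXn2r ?nnegrE ?normr_ge0 ?ltW.
  by split=> //; apply: cubic_map_escape.
have /(_ i j ltij) : {homo u : m n / (m < n)%N >-> m < n}.
  by apply: homo_ltn => [x y t|n]; [exact: lt_trans | case: (uP n)].
by rewrite /u eqij ltxx.
Qed.

(** Two points of mean [b] cannot both be smaller than [b] in norm, and the larger
one is subject to [preperiodic_bound]. *)
Lemma constant_term_bound z w :
    preperiodic (cubic_map a b) z -> preperiodic (cubic_map a b) w ->
  z + w = 2 * b -> `|b| ^+ 2 <= `|a| + 2.
Proof.
move=> prep_z prep_w sum_zw.
have bound_of u : preperiodic (cubic_map a b) u -> `|b| <= `|u| ->
    `|b| ^+ 2 <= `|a| + 2.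
  move=> prep_u leb; apply: le_trans (preperiodic_bound prep_u leb).
  by rewrite lerXn2r ?nnegrE.
have [/(bound_of _ prep_z)//|ltz] := real_leP (normr_real b) (normr_real z).
have [/(bound_of _ prep_w)//|ltw] := real_leP (normr_real b) (normr_real w).
have : `|2 * b| < `|b| + `|b|.
  by rewrite -sum_zw; apply: le_lt_trans (ler_normD _ _) _; rewrite ltrD.
by rewrite normrM normr_nat mulr_natl mulr2n ltxx.
Qed.

Lemma preperiodic_norm_bound z : `|b| ^+ 2 <= `|a| + 2 ->
  preperiodic (cubic_map a b) z -> `|z| ^+ 2 <= `|a| + 2.
Proof.
move=> leb2 prep_z.
have [/(preperiodic_bound prep_z)//|ltz] := real_leP (normr_real b) (normr_real z).
by apply: le_trans leb2; rewrite lerXn2r ?nnegrE ?normr_ge0 ?ltW.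
Qed.

Lemma sqr_norm_pair_bound z w s : `|z| ^+ 2 <= s -> `|w| ^+ 2 <= s ->
  `|z * w| <= s /\ `|z + w| ^+ 2 <= 4 * s.
Proof.
move=> lez lew; have s_ge0 : 0 <= s by apply: le_trans lez; rewrite exprn_ge0.
have lezw : `|z| * `|w| <= s.
  rewrite -(ler_pXn2r (n := 2)) ?nnegrE ?mulr_ge0 //.
  by rewrite exprMn [s ^+ 2]expr2 ler_pM ?exprn_ge0.
split; first by rewrite normrM.
apply: (@le_trans _ _ ((`|z| + `|w|) ^+ 2)).
  by rewrite lerXn2r ?nnegrE ?addr_ge0 ?normr_ge0 ?ler_normD.
have -> : (`|z| + `|w|) ^+ 2 = (`|z| ^+ 2 + `|w| ^+ 2) + (`|z| * `|w| + `|z| * `|w|) by ring.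
have -> : 4 * s = (s + s) + (s + s) by ring.
by rewrite !lerD.
Qed.

End Escape.

(** * Integrality of preperiodic points *)

Section IntegralPoly.
Variable K : fieldType.
Notation integral := (integralOver (intr : int -> K)).
Notation integral_coefs p := (forall i, integral p`_i).
Implicit Types (p q : {poly K}) (a b z d : K).

Lemma integral_exp d n : integral d -> integral (d ^+ n).
Proof.
move=> int_d; elim: n => [|n IHn]; first exact: integral1.
by rewrite exprS; apply: integral_mul.
Qed.

Lemma integral_coefsD p q :
  integral_coefs p -> integral_coefs q -> integral_coefs (p + q).
Proof. by move=> int_p int_q i; rewrite coefD; apply: integral_add. Qed.

Lemma integral_coefsM p q :
  integral_coefs p -> integral_coefs q -> integral_coefs (p * q).
Proof.
move=> int_p int_q i; rewrite coefM.
apply: (big_ind integral) => [|x y|j _]; first exact: integral0.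
  exact: integral_add.
exact: integral_mul.
Qed.

Lemma integral_coefsC d : integral d -> integral_coefs d%:P.
Proof. by move=> int_d i; rewrite coefC; case: ifP => // _; apply: integral0. Qed.

(** The iterates of the conjugate of [cubic_map a b] by the homothety of ratio [d],
cleared of denominators: the scaling factor is cubed at each step, whence the
recurrence [p ^+ 3 + a * e ^+ 2 * p + b * e ^+ 3] with [e = d ^+ (3 ^ n)]. *)
Lemma integral_iter_poly a b d n :
    integral d -> integral (d ^+ 2 * a) -> integral (d ^+ 3 * b) ->
  exists p, [/\ p \is monic, size p = (3 ^ n).+1, integral_coefs p
    & forall z, p.[d * z] = d ^+ (3 ^ n) * iter n (cubic_map a b) z].
Proof.
move=> int_d int_a int_b; elim: n => [|n [p [mon_p sz_p int_p evp]]].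
  exists 'X; split=> [||i|z]; rewrite ?monicX ?size_polyX ?hornerX ?expn0 //.
  by rewrite coefX; apply: integral_nat.
have n3_gt0 : (0 < 3 ^ n)%N by rewrite expn_gt0.
have dE : d ^+ (3 ^ n) = d ^+ (3 ^ n).-1 * d by rewrite -exprSr prednK.
pose al := d ^+ (3 ^ n) ^+ 2 * a; pose be := d ^+ (3 ^ n) ^+ 3 * b.
have int_al : integral al.
  rewrite /al dE exprMn -mulrA.
  by apply: integral_mul => //; do 2!apply: integral_exp.
have int_be : integral be.
  rewrite /be dE exprMn -mulrA.
  by apply: integral_mul => //; do 2!apply: integral_exp.
pose r := al%:P * p + be%:P.
have sz_p3 : size (p ^+ 3) = (3 ^ n.+1).+1.
  by rewrite polySpred ?expf_neq0 ?monic_neq0 // size_exp sz_p mulnC expnS.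
have sz_r : (size r < size (p ^+ 3))%N.
  rewrite sz_p3 ltnS; apply: leq_trans (size_polyD _ _) _.
  rewrite geq_max (leq_trans (size_polyC_leq1 _)) ?expn_gt0 // andbT.
  rewrite mul_polyC (leq_trans (size_scale_leq _ _)) // sz_p expnS; lia.
exists (p ^+ 3 + r); split.
- by rewrite monicE lead_coefDl // -monicE monic_exp.
- by rewrite size_polyDl.
- rewrite !exprS expr0 mulr1; do ?apply: integral_coefsD => //;
    do ?apply: integral_coefsM => //; exact: integral_coefsC.
- move=> z; rewrite iterS !hornerE evp expnS mulnC exprM /al /be /=.
  move: (iter n _ z) => u; rewrite /cubic_map; ring.
Qed.

(** With [i < j] and [iter i f z = iter j f z], the polynomials [p] and [q] of
[integral_iter_poly] for [i] and [j] give [d * z] as a root of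
[q - d ^+ (3 ^ j - 3 ^ i) * p], which is monic since [p] has the lower degree. *)
Lemma integral_preperiodic a b d z :
    integral d -> integral (d ^+ 2 * a) -> integral (d ^+ 3 * b) ->
  preperiodic (cubic_map a b) z -> integral (d * z).
Proof.
move=> int_d int_a int_b [i [j [ltij eqij]]].
have [p [mon_p sz_p int_p evp]] := integral_iter_poly i int_d int_a int_b.
have [q [mon_q sz_q int_q evq]] := integral_iter_poly j int_d int_a int_b.
have lt3 : (3 ^ i < 3 ^ j)%N by rewrite ltn_exp2l.
pose e := - d ^+ (3 ^ j - 3 ^ i).
have int_e : integral e by apply/integral_opp/integral_exp.
have sz_ep : (size (e%:P * p)%R < size q)%N.
  by rewrite mul_polyC (leq_ltn_trans (size_scale_leq _ _)) ?sz_p ?sz_q.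
pose r := q + e%:P * p; apply: (integral_root_monic (p := r)).
- by rewrite monicE lead_coefDl // -monicE.
- rewrite rootE !hornerE evp evq eqij mulrA /e mulNr -exprD subnK 1?ltnW //.
  by rewrite mulNr subrr.
- apply/integral_poly/integral_coefsD => //.
  by apply: integral_coefsM => //; apply: integral_coefsC.
Qed.

End IntegralPoly.

(** A monic integral equation of a rational number is an identity between
rationals, so it also holds in [algC], whose rational algebraic integers are
integers. *)
Lemma integral_rat_int (K : numFieldType) (x : rat) :
  integralOver (intr : int -> K) (ratr x) -> x \is a Num.int.
Proof.
case=> p mon_p px0.
suff Cint_x : (ratr x : algC) \is a Num.int.
  by have /intrP[n] := Cint_x; rewrite -(ratr_int _ n) => /fmorph_inj ->; apply: intr_int.
apply: Cint_rat_Aint; first exact: Crat_rat.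
have eqZQ (L : numFieldType) :
    map_poly (intr : int -> L) p = map_poly ratr (map_poly (intr : int -> rat) p).
  by rewrite -map_poly_comp; apply: eq_map_poly => n /=; rewrite ratr_int.
apply: (@root_monic_Aint (map_poly intr p)).
- by move: px0; rewrite (eqZQ K) (eqZQ algC) !fmorph_root.
- by rewrite monic_map.
- by apply/polyOverP => i; rewrite coef_map intr_int.
Qed.

(** * Integrality of the parameters *)

Lemma int_div_prime (p n : nat) (x : rat) : prime p ->
  x \is a Num.int -> x ^+ n / p%:R \is a Num.int -> x / p%:R \is a Num.int.
Proof.
move=> p_pr /intrP[y ->] /intrP[w ynE].
have p_neq0 : p%:R != 0 :> rat by rewrite pnatr_eq0 -lt0n prime_gt0.
have {}ynE : y ^+ n = w * p%:Z.
  by apply: (@intr_inj rat); rewrite rmorphXn rmorphM /= -ynE divfK.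
have /dvdzP[v ->] : (p %| y)%Z.
  have : (p %| y ^+ n)%Z by rewrite ynE dvdz_mull.
  by rewrite !dvdzE abszX Euclid_dvdX // => /andP[].
by rewrite rmorphM /= mulfK ?intr_int.
Qed.

(** A descent on the least common denominator [n].  If a prime [p] divides [n],
then [(n * k) ^+ 3 = (n * k ^+ 3) * n ^+ 2] and
[(n * m) ^+ 2 = (n * m ^+ 2) * n] are divisible by [p], hence so are [n * k] and
[n * m], and [n / p] is a smaller common denominator. *)
Lemma int_of_common_denominators (k m : rat) :
    (forall n : nat, (0 < n)%N -> n%:R * k \is a Num.int -> n%:R * m \is a Num.int ->
      n%:R * k ^+ 3 \is a Num.int /\ n%:R * m ^+ 2 \is a Num.int) ->
  k \is a Num.int /\ m \is a Num.int.
Proof.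
move=> den_km.
pose den n := [&& (0 < n)%N, n%:R * k \is a Num.int & n%:R * m \is a Num.int].
have ex_den : exists n, den n.
  have den_int (x : rat) : `|denq x|%:R * x \is a Num.int.
    rewrite -[X in _ * X]divq_num_den mulrC natr_absz gtr0_norm ?denq_gt0 //.
    by rewrite divfK ?intr_int // intr_eq0 denq_eq0.
  exists (`|denq k| * `|denq m|)%N; rewrite /den muln_gt0 !absz_gt0 !denq_eq0 /=.
  rewrite natrM mulrAC rpredM ?natr_int ?den_int //=.
  by rewrite -mulrA rpredM ?natr_int ?den_int.
case: (ex_minnP ex_den) => n /and3P[n_gt0 nk nm] min_n.
have [k3 m2] := den_km n n_gt0 nk nm.
have [n_gt1 | ] := ltnP 1 n; last first.
  move=> n_le1; have n1 : n = 1%N by lia.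
  by move: nk nm; rewrite n1 !mul1r.
have p_pr := pdiv_prime n_gt1; set p := pdiv n in p_pr.
have /dvdnP[n' nE] : (p %| n)%N := pdiv_dvd n.
have p_neq0 : p%:R != 0 :> rat by rewrite pnatr_eq0 -lt0n prime_gt0.
have n'E (x : rat) : n'%:R * x = n%:R * x / p%:R.
  by rewrite nE natrM mulrAC mulfK.
have : den n'.
  apply/and3P; split.
  - by move: n_gt0; rewrite nE; case: (n').
  - rewrite n'E; apply: (@int_div_prime p 3) => //.
    have -> : (n%:R * k) ^+ 3 / p%:R = n%:R * k ^+ 3 * (n * n')%:R.
      rewrite natrM.
      have -> : n'%:R = n%:R / p%:R :> rat by rewrite nE natrM mulfK.
      by ring.
    by rewrite rpredM ?natr_int.
  - rewrite n'E; apply: (@int_div_prime p 2) => //.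
    have -> : (n%:R * m) ^+ 2 / p%:R = n%:R * m ^+ 2 * n'%:R.
      have -> : n'%:R = n%:R / p%:R :> rat by rewrite nE natrM mulfK.
      by ring.
    by rewrite rpredM ?natr_int.
move=> /min_n; rewrite leqNgt => /negP[].
by move: n_gt0; rewrite nE muln_gt0 => /andP[? _]; rewrite ltn_Pmulr ?prime_gt1.
Qed.

Lemma integral_sqr (K : fieldType) (x : K) :
  integralOver (intr : int -> K) (x ^+ 2) -> integralOver (intr : int -> K) x.
Proof.
move=> int_x2; apply: (integral_root_monic (p := 'X^2 - (x ^+ 2)%:P)).
- exact: monicXnsubC.
- by rewrite rootE !hornerE subrr.
apply/integral_poly => i; rewrite coefB coefXn.
by apply: integral_sub; [exact: integral_nat | exact: integral_coefsC].
Qed.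

Lemma integral_ratr (K : numFieldType) (x : rat) :
  x \is a Num.int -> integralOver (intr : int -> K) (ratr x).
Proof. by case/intrP=> n ->; rewrite ratr_int; apply: integral_id. Qed.

Section CriticalOrbits.
Variables (K : numClosedFieldType) (k m : rat) (c : K).
Let f : K -> K := cubic_map (ratr (- (3 / 4) * k)) (ratr (m / 4)).
Hypothesis c2 : c ^+ 2 = ratr (k / 4).
Hypotheses (prep_c : preperiodic f c) (prep_cN : preperiodic f (- c)).

Let fE z : f z = z ^+ 3 - 3 / 4 * ratr k * z + ratr m / 4.
Proof.
by rewrite /f /cubic_map !(rmorphM, rmorphN, fmorphV, rmorph_nat) /=; ring.
Qed.

Let c2E : c ^+ 2 = ratr k / 4.
Proof. by rewrite c2 !(rmorphM, fmorphV, rmorph_nat). Qed.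

(** The scaling factor [d = 2 * sqrtC n] makes [d ^+ 2 * A = - 3 * (n * k)] and
[d ^+ 3 * B = d * (n * m)] integral.  The difference of the critical values is
[- k * c] and their sum is [m / 2]; multiplied by [d] and squared, these become
[n * k ^+ 3] and [n * m ^+ 2]. *)
Lemma critical_value_integrality (n : nat) :
    n%:R * k \is a Num.int -> n%:R * m \is a Num.int ->
  n%:R * k ^+ 3 \is a Num.int /\ n%:R * m ^+ 2 \is a Num.int.
Proof.
move=> nk nm; pose d : K := 2 * sqrtC n%:R.
have d2 : d ^+ 2 = 4 * n%:R by rewrite exprMn sqrtCK; ring.
have int_d : integralOver (intr : int -> K) d.
  by apply: integral_sqr; rewrite d2 -natrM; apply: integral_nat.
have int_a : integralOver (intr : int -> K) (d ^+ 2 * ratr (- (3 / 4) * k)).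
  have -> : d ^+ 2 * ratr (- (3 / 4) * k) = ratr (- 3 * (n%:R * k)).
    rewrite d2 !(rmorphM, rmorphN, fmorphV, rmorph_nat) /=.
    by field.
  by apply: integral_ratr; rewrite rpredM ?rpredN ?natr_int.
have int_b : integralOver (intr : int -> K) (d ^+ 3 * ratr (m / 4)).
  have -> : d ^+ 3 * ratr (m / 4) = d * ratr (n%:R * m).
    rewrite exprS d2 !(rmorphM, fmorphV, rmorph_nat) /=.
    by field.
  by apply: integral_mul => //; apply: integral_ratr.
have int_p : integralOver (intr : int -> K) (d * f c).
  exact: integral_preperiodic int_d int_a int_b (preperiodic_iter 1 prep_c).
have int_q : integralOver (intr : int -> K) (d * f (- c)).
  exact: integral_preperiodic int_d int_a int_b (preperiodic_iter 1 prep_cN).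
split; apply: (@integral_rat_int K).
  have -> : ratr (n%:R * k ^+ 3) = (d * f c - d * f (- c)) ^+ 2.
    transitivity (4 * d ^+ 2 * c ^+ 2 * (c ^+ 2 - 3 / 4 * ratr k) ^+ 2).
      by rewrite d2 c2E rmorphM rmorphXn /= ratr_nat; field.
    by rewrite !fE; ring.
  by apply/integral_exp/integral_sub.
have -> : ratr (n%:R * m ^+ 2) = (d * f c + d * f (- c)) ^+ 2.
  transitivity (d ^+ 2 * (ratr m / 2) ^+ 2).
    by rewrite d2 rmorphM rmorphXn /= ratr_nat; field.
  by rewrite !fE; field.
by apply/integral_exp/integral_add.
Qed.

End CriticalOrbits.

Lemma intr_of_integral (K : numFieldType) (x : int) (d : nat) : (0 < d)%N ->
  integralOver (intr : int -> K) (x%:~R / d%:R) -> exists y, x = y * d%:Z.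
Proof.
move=> d_gt0 int_xd; have d_neq0 : d%:R != 0 :> rat by rewrite pnatr_eq0 -lt0n.
have : x%:~R / d%:R \is a @Num.int rat.
  by apply: (@integral_rat_int K); rewrite fmorph_div /= ratr_int ratr_nat.
case/intrP=> y yE; exists y; apply: (@intr_inj rat).
by rewrite rmorphM /= -yE divfK.
Qed.

(** * The finite search *)

(** With [a = - 3 k / 4], [b = m / 4] and [f] the map [cubic_map a b], let [t] and
[n] be the sum and product of [2 * z] and [2 * w].  These are 4 times the sum
and 16 times the product of [2 * f z] and [2 * f w]. *)
Definition trace_step (k m t n : int) : int :=
  t ^+ 3 - 3 * t * n - 3 * k * t + 4 * m.

Definition norm_step (k m t n : int) : int :=
  n ^+ 3 - 3 * k * n * (t ^+ 2 - 2 * n) + 9 * k ^+ 2 * n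
  + 2 * m * (t ^+ 3 - 3 * t * n) - 6 * k * m * t + 4 * m ^+ 2.

(** With [4 * (`|a| + 2) = 3 * `|k| + 8], the size conditions are
[preperiodic_norm_bound] read on the product [n] and on the sum [t]; the
divisibility conditions express integrality of the next pair.  Nested
conditionals stop the computation before the numbers become large. *)
Fixpoint survives (steps : nat) (k m t n : int) : bool :=
  if (`|n| <= 3 * `|k| + 8) && (t ^+ 2 <= 12 * `|k| + 32) then
    if steps is steps'.+1 then
      let t4 := trace_step k m t n in
      let n16 := norm_step k m t n in
      if (4 %| t4)%Z && (16 %| n16)%Z then
        survives steps' k m (t4 %/ 4)%Z (n16 %/ 16)%Z
      else false
    else true
  else false.

Definition pcf_parameters : seq (int * int) :=
  [:: (4, 0); (2, 0); (1, 3); (1, -3); (0, 0); (-2, 0); (-4, 0)].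

(** The orbits start from [2 * c] and [- 2 * c], whose sum is [0] and whose product
is [- 4 * c ^+ 2 = - k]. *)
Lemma small_survivors (k m : int) :
    `|k| <= 4 -> `|m| <= 8 -> survives 3 k m 0 (- k) ->
  (k, m) \in pcf_parameters.
Proof.
move=> lek lem.
pose window b : seq int := [seq i%:Z - b%:Z | i <- iota 0 (2 * b).+1].
have in_window (b : nat) (x : int) : `|x| <= b%:Z -> x \in window b.
  move=> lex; apply/mapP; exists `|(x + b%:Z)%R|%N; last lia.
  by rewrite mem_iota; lia.
have: all (fun k => all (fun m =>
    survives 3 k m 0 (- k) ==> ((k, m) \in pcf_parameters)) (window 8%N)) (window 4%N).
  by vm_compute.
by move=> /allP/(_ k (in_window _ _ lek))/allP/(_ m (in_window _ _ lem))/implyP.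
Qed.

(** * Reduction to the finite search *)

Section Reduction.
Variables (K : numClosedFieldType) (k m : int) (c : K).
Let a : K := - (3 / 4) * k%:~R.
Let b : K := m%:~R / 4.
Let f : K -> K := cubic_map a b.
Hypothesis c2 : c ^+ 2 = k%:~R / 4.
Hypotheses (prep_c : preperiodic f c) (prep_cN : preperiodic f (- c)).

Let z n := iter n f c.
Let w n := iter n f (- c).
Let prep_z n : preperiodic f (z n). Proof. exact: preperiodic_iter. Qed.
Let prep_w n : preperiodic f (w n). Proof. exact: preperiodic_iter. Qed.

Let norm_aE : 4 * (`|a| + 2) = (3 * `|k| + 8)%:~R.
Proof.
rewrite /a !(normrM, normrN, normfV, normr_nat) rmorphD rmorphM /= intr_norm.
by field.
Qed.

Let leb : `|b| ^+ 2 <= `|a| + 2.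
Proof.
apply: (constant_term_bound (prep_z 1) (prep_w 1)).
by rewrite /z /w /= /f /cubic_map; ring.
Qed.

Let orbit_bound n : `|z n * w n| <= `|a| + 2 /\ `|z n + w n| ^+ 2 <= 4 * (`|a| + 2).
Proof. by apply: sqr_norm_pair_bound; apply: (preperiodic_norm_bound leb). Qed.

Let norm_a4E : 4 * (4 * (`|a| + 2)) = (4 * (3 * `|k| + 8))%:~R.
Proof. by rewrite rmorphM /= norm_aE. Qed.

(** The critical values have mean [b] and difference [- k * c], whose square is
[k ^+ 3 / 4]. *)
Lemma parameters_bound : `|k| <= 4 /\ `|m| <= 8.
Proof.
have le_m : `|m| ^+ 2 <= 4 * (3 * `|k| + 8).
  rewrite -(ler_int K) rmorphXn /= -norm_a4E intr_norm.
  have -> : `|m%:~R| ^+ 2 = 4 * 4 * `|b| ^+ 2.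
    by rewrite /b normrM normfV normr_nat; field.
  by rewrite -mulrA !ler_pM2l.
have le_k : `|k| ^+ 3 <= 4 * (3 * `|k| + 8).
  rewrite -(ler_int K) rmorphXn /= -norm_a4E intr_norm.
  have -> : `|k%:~R| ^+ 3 = 4 * `|z 1 + - w 1| ^+ 2.
    rewrite -[4 in RHS](normr_nat K) -!normrX -normrM; congr `|_|.
    transitivity (4 * (4 * c ^+ 2 * (c ^+ 2 + a) ^+ 2)).
      by rewrite c2 /a; field.
    by rewrite /z /w /= /f /cubic_map; ring.
  rewrite ler_pM2l //; apply: (sqr_norm_pair_bound _ _).2; rewrite ?normrN.
    exact: (preperiodic_norm_bound leb).
  exact: (preperiodic_norm_bound leb).
(* 4 is the last integer [x] with [x ^+ 3 <= 12 * x + 32], and [9 ^+ 2 > 80]. *)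
have k_le4 : `|k| <= 4 by nia.
by split=> //; nia.
Qed.

Lemma twice_orbit_integral u :
  preperiodic f u -> integralOver (intr : int -> K) (2 * u).
Proof.
apply: integral_preperiodic; first exact: integral_nat.
  have -> : 2 ^+ 2 * a = (- 3 * k)%:~R by rewrite /a rmorphM rmorphN /=; field.
  exact: integral_id.
have -> : 2 ^+ 3 * b = (2 * m)%:~R by rewrite /b rmorphM /=; field.
exact: integral_id.
Qed.

Let size_bounds i (t n : int) :
    t%:~R = 2 * (z i + w i) -> n%:~R = 4 * (z i * w i) ->
  (`|n| <= 3 * `|k| + 8) && (t ^+ 2 <= 12 * `|k| + 32).
Proof.
move=> tE nE; have [le_n le_t] := orbit_bound i.
have -> : `|n| <= 3 * `|k| + 8.
  by rewrite -(ler_int K) -norm_aE intr_norm nE normrM normr_nat ler_pM2l.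
have -> : 12 * `|k| + 32 = 4 * (3 * `|k| + 8) :> int by ring.
rewrite -[t ^+ 2]real_normK ?num_real // -(ler_int K) rmorphXn /= -norm_a4E intr_norm tE.
rewrite normrM normr_nat exprMn.
have -> : 2 ^+ 2 = 4 :> K by ring.
by rewrite ler_pM2l.
Qed.

(** The rationals [t4 / 4] and [n16 / 16] are the sum and product of the next pair
of doubled iterates, so they are algebraic integers, hence integers. *)
Lemma orbits_survive steps i (t n : int) :
    t%:~R = 2 * (z i + w i) -> n%:~R = 4 * (z i * w i) ->
  survives steps k m t n.
Proof.
elim: steps i t n => [|steps IH] i t n tE nE /=.
  by rewrite (size_bounds tE nE).
rewrite (size_bounds tE nE); set t4 := trace_step k m t n.
set n16 := norm_step k m t n.
have t4E : t4%:~R = 4 * (2 * (z i.+1 + w i.+1)) :> K.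
  rewrite /t4 /trace_step !(rmorphD, rmorphN, rmorphM, rmorphXn) /= tE nE.
  by rewrite -/(z i) -/(w i); move: (z i) (w i) => u v; rewrite /f /cubic_map /a /b; field.
have n16E : n16%:~R = 16 * (4 * (z i.+1 * w i.+1)) :> K.
  rewrite /n16 /norm_step !(rmorphD, rmorphN, rmorphM, rmorphXn) /= tE nE.
  by rewrite -/(z i) -/(w i); move: (z i) (w i) => u v; rewrite /f /cubic_map /a /b; field.
have /(@intr_of_integral K _ 4 isT)[t' t'E] : integralOver (intr : int -> K) (t4%:~R / 4%:R).
  by rewrite t4E mulrAC divff ?mul1r ?pnatr_eq0 // mulrDr;
    apply: integral_add; apply: twice_orbit_integral.
have /(@intr_of_integral K _ 16 isT)[n' n'E] : integralOver (intr : int -> K) (n16%:~R / 16%:R).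
  rewrite n16E mulrAC divff ?mul1r ?pnatr_eq0 //.
  have -> : 4 * (z i.+1 * w i.+1) = (2 * z i.+1) * (2 * w i.+1) by ring.
  by apply: integral_mul; apply: twice_orbit_integral.
rewrite t'E n'E !dvdz_mull //= !mulzK //; apply: (IH i.+1).
  by apply: (mulfI (x := 4)); rewrite ?pnatr_eq0 // -t4E t'E rmorphM /= mulrC.
by apply: (mulfI (x := 16)); rewrite ?pnatr_eq0 // -n16E n'E rmorphM /= mulrC.
Qed.

End Reduction.

(** * The classification *)

Lemma preperiodic_critical_points_classification
    (K : numClosedFieldType) (A B : rat) (c : K) :
    c ^+ 2 = - ratr A / 3 ->
    preperiodic (cubic_map (ratr A) (ratr B)) c ->
    preperiodic (cubic_map (ratr A) (ratr B)) (- c) ->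
  exists2 km : int * int, km \in pcf_parameters
    & (A, B) = (- (3 / 4) * km.1%:~R, km.2%:~R / 4).
Proof.
pose k : rat := - (4 / 3) * A; pose m : rat := 4 * B.
have -> : A = - (3 / 4) * k by rewrite /k; field.
have -> : B = m / 4 by rewrite /m; field.
move=> c2 prep_c prep_cN.
have {}c2 : c ^+ 2 = ratr (k / 4).
  by rewrite c2 !(rmorphM, rmorphN, fmorphV, rmorph_nat) /=; field.
have [/intrP[k' kE] /intrP[m' mE]] : k \is a Num.int /\ m \is a Num.int.
  apply: int_of_common_denominators => n _.
  exact: critical_value_integrality c2 prep_c prep_cN n.
rewrite {}kE {}mE in c2 prep_c prep_cN *.
have aE : ratr (- (3 / 4) * k'%:~R) = - (3 / 4) * k'%:~R :> K.
  by rewrite !(rmorphM, rmorphN, fmorphV, rmorph_nat, rmorph_int).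
have bE : ratr (m'%:~R / 4) = m'%:~R / 4 :> K.
  by rewrite !(rmorphM, fmorphV, rmorph_nat, rmorph_int).
rewrite {}aE {}bE in prep_c prep_cN.
have {}c2 : c ^+ 2 = k'%:~R / 4.
  by rewrite c2 !(rmorphM, fmorphV, rmorph_nat, rmorph_int).
exists (k', m') => //.
have [le_k le_m] := parameters_bound c2 prep_c prep_cN.
apply: small_survivors => //.
apply: (orbits_survive prep_c prep_cN _ (i := 0%N)) => /=.
  by rewrite subrr mulr0.
by rewrite rmorphN mulrN -expr2 c2; field.
Qed.

Theorem mainTheorem4 (R : realType) (A B : rat) :
  post_critically_finite (cubic R A B) ->
  (A, B) \in [:: (- 3, 0); (- (3 / 2), 0); (- (3 / 4), 3 / 4);
                 (- (3 / 4), - (3 / 4)); (0, 0); (3 / 2, 0); (3, 0)].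
Proof.
move=> pcf; pose c : complex R := sqrtC (- ratr A / 3).
have c2 : c ^+ 2 = - ratr A / 3 by apply: sqrtCK.
have prep (z : complex R) : z ^+ 2 = - ratr A / 3 ->
    preperiodic (cubic_map (ratr A) (ratr B)) z.
  have horner_cubic : horner (cubic R A B) =1 cubic_map (ratr A) (ratr B).
    by move=> u; rewrite /cubic /cubic_map !hornerE.
  move=> z2; apply: (eq_preperiodic horner_cubic).
  apply/finite_orbit_preperiodic/pcf.
  rewrite /critical_point rootE /cubic !derivE !hornerE /=.
  have -> : z * z + z * (z + z) + ratr A = 3 * z ^+ 2 + ratr A by ring.
  by rewrite z2; apply/eqP; field.
have [|km km_in ->] := preperiodic_critical_points_classification c2 (prep c c2).
  by apply: prep; rewrite sqrrN.
by move: km km_in; apply/allP; vm_compute.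
Qed.
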